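(* Let $\mathbb{K}$ be any field and let $\mathcal{A}=\mathcal{A}_n^{\bar q,\Lambda}(\mathbb{K})$ with $\bar q=(q_1,\dots,q_n)$ such that no $q_i$ is a root of unity. Then the height-one prime ideals of $\mathcal{A}$ are exactly the two-sided ideals $(z_1),(z_2),\dots,(z_n)$.
   Context: Let $\mathbb{K}$ be a field, $n\ge 1$, $\bar q=(q_1,\dots,q_n)\in(\mathbb{K}^* )^n$, and $\Lambda=(\lambda_{ij})_{1\le i,j\le n}$ a matrix with entries in $\mathbb{K}^*$ such that $\lambda_{ij}=\lambda_{ji}^{-1}$ and $\lambda_{ii}=1$. The ''symmetric'' multiparameter quantized Weyl algebra $\mathcal{A}_n^{\bar q,\Lambda}(\mathbb{K})$ is the $\mathbb{K}$-algebra generated by $x_1,y_1,\dots,x_n,y_n$ subject to: for all $1\le i<j\le n$, $x_ix_j=\lambda_{ij}x_jx_i$, $y_jy_i=\lambda_{ji}y_iy_j$, $x_iy_j=\lambda_{ji}y_jx_i$, $x_jy_i=\lambda_{ij}y_ix_j$; and $x_iy_i-q_iy_ix_i=1$ for all $1\le i\le n$. For each $i$ put $z_i=x_iy_i-y_ix_i$; then $z_i=1+(q_i-1)y_ix_i$, $z_iy_i=q_iy_iz_i$, $z_ix_i=q_i^{-1}x_iz_i$, $z_i$ commutes with $x_j,y_j$ for $j\neq i$, and the $z_i$ commute pairwise; in particular each $z_i$ is a normal element. $(z_i)$ denotes the two-sided ideal generated by $z_i$. *)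

(* Defs.v *)
From HB Require Import structures.
From mathcomp Require Import all_boot all_order all_algebra.
Set Implicit Arguments. Unset Strict Implicit. Unset Printing Implicit Defensive.
Import GRing.Theory.
Local Open Scope ring_scope.

Definition alg_hom (K : fieldType) (A B : algType K) (f : A -> B) : Prop :=
  [/\ forall (a : K) (u v : A), f (a *: u + v) = a *: f u + f v,
      f 1 = 1 &
      forall u v : A, f (u * v) = f u * f v].

Definition qweyl_rel (K : fieldType) (n : nat) (q : 'I_n -> K)
    (lam : 'I_n -> 'I_n -> K) (B : algType K) (x y : 'I_n -> B) : Prop :=
  (forall i j : 'I_n, (i < j)%N ->
     [/\ x i * x j = lam i j *: (x j * x i),
         y j * y i = lam j i *: (y i * y j),
         x i * y j = lam j i *: (y j * x i) &
         x j * y i = lam i j *: (y i * x j)]) /\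
  (forall i : 'I_n, x i * y i - q i *: (y i * x i) = 1).

(* (A, x, y) is THE algebra generated by x_i, y_i subject to qweyl_rel,
   i.e. it satisfies the relations and is initial (universal property of
   the presentation by generators and relations). *)
Definition is_qweyl_algebra (K : fieldType) (n : nat) (q : 'I_n -> K)
    (lam : 'I_n -> 'I_n -> K) (A : algType K) (x y : 'I_n -> A) : Prop :=
  qweyl_rel q lam x y /\
  forall (B : algType K) (xb yb : 'I_n -> B), qweyl_rel q lam xb yb ->
    (exists f : A -> B, alg_hom f /\ forall i, f (x i) = xb i /\ f (y i) = yb i) /\
    (forall f g : A -> B, alg_hom f -> alg_hom g ->
       (forall i, f (x i) = g (x i) /\ f (y i) = g (y i)) ->
       forall u, f u = g u).

Definition ideal (R : nzRingType) (I : R -> Prop) : Prop :=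
  [/\ I 0,
      forall u v, I u -> I v -> I (u + v) &
      forall a u, I u -> I (a * u) /\ I (u * a)].

Definition gen_ideal (R : nzRingType) (z : R) : R -> Prop :=
  fun u => forall I : R -> Prop, ideal I -> I z -> I u.

Definition prime_ideal (R : nzRingType) (P : R -> Prop) : Prop :=
  [/\ ideal P, ~ P 1 &
      forall I J : R -> Prop, ideal I -> ideal J ->
        (forall a b, I a -> J b -> P (a * b)) ->
        (forall a, I a -> P a) \/ (forall b, J b -> P b)].

Definition strict_sub (R : Type) (P Q : R -> Prop) : Prop :=
  (forall u, P u -> Q u) /\ exists u, Q u /\ ~ P u.

Definition height_one_prime (R : nzRingType) (P : R -> Prop) : Prop :=
  [/\ prime_ideal P,
      exists Q, prime_ideal Q /\ strict_sub Q P &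
      ~ exists Q1 Q2, [/\ prime_ideal Q1, prime_ideal Q2,
                          strict_sub Q1 Q2 & strict_sub Q2 P]].

(* Main.v *)
(** Write t_i^d for y_i^d if d >= 0 and x_i^(-d) otherwise.  The monomials
    T_d z^k, with T_d = t_1^(d_1) ... t_n^(d_n), span the algebra.  If a linear
    combination of them with nonzero coefficients lies in an ideal I, comparing
    left and right multiplication by the z_i isolates one degree d (the q_i are
    not roots of unity), comparing left and right multiplication by the t_i then
    isolates one exponent k, and q-commutators with x_i, y_i strip off T_d, so
    that I contains a monomial z^k.  Linear independence of the monomials is
    never needed: it is replaced by a representation on functions on Z^n in which
    the z_i act diagonally, with prescribed z_i acting by 0 and the others
    invertibly.  Hence 0 is prime and every nonzero prime contains some z_i.  The
    ideal (z_i) is stable under the grading by d_i, so its primeness may be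
    tested on top-degree components, where the same separation applies to the
    remaining indices. *)
Require Import Defs.
From HB Require Import structures.
From mathcomp Require Import all_boot all_order all_algebra.
From mathcomp Require Import boolp functions ring.
Import GRing.Theory.
Local Open Scope ring_scope.

Set Implicit Arguments.
Unset Strict Implicit.
Unset Printing Implicit Defensive.

(** * Linear endomorphisms and subalgebras *)

Section EndAlgebra.
Context (K : fieldType) (V : lmodType K) (nzV : exists v : V, v != 0).

Definition linear_pred : {pred (V -> V)} := fun f => `[< linear f >].
Lemma linear_pred_submod : submod_closed linear_pred.
Proof.
split=> [|a f g /asboolP lf /asboolP lg]; apply/asboolP => b u v.
  by rewrite [RHS](_ : _ = b *: 0 + 0) // scaler0 addr0.
rewrite [LHS](_ : _ = a *: f (b *: u + v) + g (b *: u + v)) //.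
rewrite [RHS](_ : _ = b *: (a *: f u + g u) + (a *: f v + g v)) //.
by rewrite lf lg !scalerDr !scalerA addrACA (mulrC a).
Qed.
HB.instance Definition _ :=
  GRing.isSubmodClosed.Build K (V -> V) linear_pred linear_pred_submod.

Record lend := Lend { lend_fun :> V -> V; lend_linP : lend_fun \in linear_pred }.
HB.instance Definition _ := [isSub for lend_fun].
HB.instance Definition _ := [Choice of lend by <:].
HB.instance Definition _ := [SubChoice_isSubLmodule of lend by <:].

Lemma lend_lin (f : lend) : linear f.
Proof. by apply/asboolP; case: f. Qed.

Lemma lendP (f g : lend) : f =1 g -> f = g.
Proof. by move=> fg; apply/val_inj/funext. Qed.

Lemma id_linear_pred : id \in linear_pred.
Proof. exact/asboolP. Qed.
Definition lend_one := Lend id_linear_pred.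

Lemma comp_linear_pred (f g : lend) : f \o g \in linear_pred.
Proof. by apply/asboolP => a u v /=; rewrite !lend_lin. Qed.
Definition lend_comp f g := Lend (comp_linear_pred f g).

Fact lend_compA : associative lend_comp.
Proof. by move=> f g h; apply: lendP. Qed.
Fact lend_comp1l : left_id lend_one lend_comp.
Proof. by move=> f; apply: lendP. Qed.
Fact lend_comp1r : right_id lend_one lend_comp.
Proof. by move=> f; apply: lendP. Qed.
Fact lend_compDl : left_distributive lend_comp +%R.
Proof. by move=> f g h; apply: lendP. Qed.
Fact lend_compDr : right_distributive lend_comp +%R.
Proof.
move=> f g h; apply: lendP => v; have := lend_lin f 1 (g v) (h v).
by rewrite !scale1r.
Qed.
Fact lend_one_neq0 : lend_one != 0.
Proof.
case: nzV => v v0; apply/eqP => /(congr1 (fun f : lend => f v)) /= vE.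
by rewrite vE eqxx in v0.
Qed.
HB.instance Definition _ := GRing.Zmodule_isNzRing.Build lend
  lend_compA lend_comp1l lend_comp1r lend_compDl lend_compDr lend_one_neq0.
Fact lend_scaleAl a (f g : lend) : a *: (f * g) = (a *: f) * g.
Proof. exact: lendP. Qed.
HB.instance Definition _ := GRing.Lmodule_isLalgebra.Build K lend lend_scaleAl.
Fact lend_scaleAr a (f g : lend) : a *: (f * g) = f * (a *: g).
Proof.
have f0 : f 0 = 0 by have := lend_lin f (-1) 0 0; rewrite scaler0 addr0 scaleN1r addNr.
by apply: lendP => v; have := lend_lin f a (g v) 0; rewrite f0 !addr0.
Qed.
HB.instance Definition _ := GRing.Lalgebra_isAlgebra.Build K lend lend_scaleAr.

Definition lend_alg : algType K := lend.

End EndAlgebra.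

Section Subalgebra.
Context (K : fieldType) (A : algType K) (S : A -> Prop).
Definition subalg_pred : {pred A} := fun u => `[< S u >].
Context (hS : subalg_closed subalg_pred).
HB.instance Definition _ := GRing.isSubalgClosed.Build K A subalg_pred hS.
Record subalg := Subalg { subalg_val : A; _ : subalg_val \in subalg_pred }.
HB.instance Definition _ := [isSub for subalg_val].
HB.instance Definition _ := [Choice of subalg by <:].
HB.instance Definition _ := [SubChoice_isSubAlgebra of subalg by <:].
Definition subalg_alg : algType K := subalg.
End Subalgebra.

(* The map from A to a subalgebra containing the generators, followed by the
   inclusion, is the identity by the uniqueness part of the universal property. *)
Lemma qweyl_generated (K : fieldType) (n : nat) (q : 'I_n -> K)
    (lam : 'I_n -> 'I_n -> K) (A : algType K) (x y : 'I_n -> A) (S : A -> Prop) :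
    is_qweyl_algebra q lam x y -> subalg_closed (subalg_pred S) ->
    (forall i, S (x i)) -> (forall i, S (y i)) ->
  forall u, S u.
Proof.
move=> [hrel huniv] hS Sx Sy u.
have px i : x i \in subalg_pred S by apply/asboolP.
have py i : y i \in subalg_pred S by apply/asboolP.
pose B := subalg_alg hS.
pose xb i : B := Subalg (px i); pose yb i : B := Subalg (py i).
have hB : qweyl_rel q lam xb yb.
  case: hrel => h1 h2; split=> [i j ij|i].
    by case: (h1 i j ij) => *; split; apply: val_inj.
  by apply: val_inj; apply: h2.
have [[f [[f1 f2 f3] fxy]] _] := huniv B xb yb hB.
have [_ hu] := huniv A x y hrel.
have <- : val (f u) = u.
  apply: (hu (fun v => val (f v)) id) => // [|i].
    by split=> [a v w||v w]; rewrite ?f1 ?f2 ?f3.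
  by have [-> ->] := fxy i.
by case: (f u) => v /= /asboolP.
Qed.

(** * The representation on functions on Z^n *)

Section Representation.
Context (K : fieldType) (n : nat) (q : 'I_n -> K) (lam : 'I_n -> 'I_n -> K).
Context (c : 'I_n -> K).
Hypothesis hq0 : forall i, q i != 0.
Hypothesis hq1 : forall i, q i - 1 != 0.
Hypothesis hlam0 : forall i j, lam i j != 0.
Hypothesis hlaminv : forall i j, lam i j = (lam j i)^-1.

Let V : lmodType K := (('I_n -> int) -> K^o).

Definition ishift (i : 'I_n) (s : int) (d : 'I_n -> int) : 'I_n -> int :=
  fun j => d j + (if i == j then s else 0).

(** A cocycle for the [lam] relations: since only [j < i] contribute, for [i < j] a shift in
    direction [i] rescales [twist j], while a shift in direction [j] leaves [twist i] alone. *)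
Definition twist (i : 'I_n) (d : 'I_n -> int) : K :=
  \prod_(j < n | (j < i)%N) lam i j ^ d j.

Lemma twist_neq0 i d : twist i d != 0.
Proof. by apply/prodf_neq0 => j _; rewrite expfz_neq0. Qed.

Lemma twist_ge (i j : 'I_n) s d : (i <= j)%N -> twist i (ishift j s d) = twist i d.
Proof.
move=> ij; apply: eq_bigr => k ki; rewrite /ishift.
by case: eqP => [jk|_]; rewrite ?addr0 //; move: ki; rewrite -jk ltnNge ij.
Qed.

Lemma twist_lt (i j : 'I_n) s d : (i < j)%N ->
  twist j (ishift i s d) = lam j i ^ s * twist j d.
Proof.
move=> ij; rewrite /twist (bigD1 i) //= [in RHS](bigD1 i) //= mulrA.
rewrite {1}/ishift eqxx expfzDr // (mulrC (_ ^ d i)); congr (_ * _ * _).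
apply: eq_bigr => k /andP[_ ki]; rewrite /ishift.
by rewrite eq_sym (negPf ki) addr0.
Qed.

Lemma ishiftC i j s t d : ishift i s (ishift j t d) = ishift j t (ishift i s d).
Proof. by apply/funext => k; rewrite /ishift addrAC. Qed.

Lemma ishiftK i s d : ishift i s (ishift i (- s) d) = d.
Proof.
apply/funext => k; rewrite /ishift.
by case: eqP => _; rewrite ?addr0 // -addrA addNr addr0.
Qed.

(* Makes z_i act at d by c_i q_i^(d_i - 1), so that c_i = 0 kills z_i. *)
Definition hcoef i (d : 'I_n -> int) : K := (c i * q i ^ d i - 1) / (q i - 1).

Lemma shift_op_linear (g : ('I_n -> int) -> K) (s : ('I_n -> int) -> 'I_n -> int) :
  ((fun f d => g d * f (s d)) : V -> V) \in linear_pred (V := V).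
Proof.
apply/asboolP => a u v; apply/funext => d.
rewrite [LHS](_ : _ = g d * (a * u (s d) + v (s d))) //.
rewrite [RHS](_ : _ = a * (g d * u (s d)) + g d * v (s d)) //.
by rewrite mulrDr mulrCA.
Qed.

Let one_fun : V := fun _ => 1.
Fact one_fun_neq0 : exists v : V, v != 0.
Proof.
exists one_fun; apply/eqP => /(congr1 (fun f : V => f (fun=> 0))) /eqP.
by rewrite oner_eq0.
Qed.

Definition qweyl_rep : algType K := lend_alg one_fun_neq0.

(** Opposite weighted shifts: the twists cancel in [x_i y_i] and [y_i x_i], which therefore act
    diagonally. *)
Definition yrep i : qweyl_rep := Lend (shift_op_linear (twist i) (ishift i (-1))).
Definition xrep i : qweyl_rep :=
  Lend (shift_op_linear (fun d => (twist i d)^-1 * hcoef i d) (ishift i 1)).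

Lemma yrepE i f d : yrep i f d = twist i d * f (ishift i (-1) d). Proof. by []. Qed.
Lemma xrepE i f d : xrep i f d = (twist i d)^-1 * hcoef i d * f (ishift i 1 d).
Proof. by []. Qed.

Lemma hcoef_neq i j s d : i != j -> hcoef i (ishift j s d) = hcoef i d.
Proof. by move=> ij; rewrite /hcoef /ishift eq_sym (negPf ij) addr0. Qed.

Lemma repP (f g : qweyl_rep) : (forall v d, f v d = g v d) -> f = g.
Proof. by move=> fg; apply: lendP => v; apply/funext. Qed.

Lemma repM (f g : qweyl_rep) v d : (f * g) v d = f (g v) d. Proof. by []. Qed.
Lemma repZ a (f : qweyl_rep) v d : (a *: f) v d = a * f v d. Proof. by []. Qed.
Lemma repB (f g : qweyl_rep) v d : (f - g) v d = f v d - g v d. Proof. by []. Qed.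
Lemma rep1 v d : (1 : qweyl_rep) v d = v d. Proof. by []. Qed.

Lemma xyrep i v d : (xrep i * yrep i) v d = hcoef i d * v d.
Proof.
rewrite repM xrepE yrepE twist_ge // -[in X in _ * (_ * v X)](opprK 1) ishiftK.
by rewrite mulrA [_ * twist i d]mulrC mulrA divff ?mul1r // twist_neq0.
Qed.

Lemma yxrep i v d : (yrep i * xrep i) v d = hcoef i (ishift i (-1) d) * v d.
Proof.
by rewrite repM yrepE xrepE twist_ge // ishiftK !mulrA divff ?mul1r // twist_neq0.
Qed.

Lemma hcoef_shift i d :
  hcoef i (ishift i (-1) d) = (c i * (q i)^-1 * q i ^ d i - 1) / (q i - 1).
Proof.
by rewrite /hcoef /ishift eqxx expfzDr // -mulrA; congr ((_ * _ - 1) / _); rewrite mulrC.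
Qed.

Lemma rep_rel : qweyl_rel q lam xrep yrep.
Proof.
split=> [i j ij|i]; last first.
  (* The terms in [c i] cancel in this combination of two values of [hcoef], leaving
     [(q_i - 1) / (q_i - 1)]; this is what keeps [c] free. *)
  apply: repP => v d; rewrite repB repZ xyrep yxrep rep1 hcoef_shift /hcoef.
  by field; rewrite hq0 hq1.
have neij : i != j by rewrite -val_eqE /= ltn_eqF.
have neji : j != i by rewrite eq_sym.
have lji : lam j i = (lam i j)^-1 := hlaminv j i.
have l0 := hlam0 i j.
split; apply: repP => v d; rewrite repZ !repM !(xrepE, yrepE) ishiftC ?hcoef_neq //.
all: rewrite ?(twist_lt _ _ ij) ?(twist_ge _ _ (ltnW ij)) lji ?expr1z ?exprN1.
all: by field; rewrite ?twist_neq0 ?l0 ?oner_neq0.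
Qed.

Lemma zrepE i v d :
  (xrep i * yrep i - yrep i * xrep i) v d = c i * q i ^ (d i - 1) * v d.
Proof.
rewrite repB xyrep yxrep hcoef_shift /hcoef expfzDr // exprN1.
by field; rewrite hq0 hq1.
Qed.
End Representation.

(** * Separation of eigenvectors modulo an ideal *)

Section ClassSeparation.
Context (K : fieldType) (A : lmodType K) (J : Type) (P : eqType).
(** The pairs [L j], [R j] will be left and right multiplication by one element, or an automorphism
    and the identity. By [LR], applying [R i] multiplies all eigenvalues for [j] by the same nonzero
    [nu j i], so unequal eigenvalues stay unequal. *)
Context (L R : J -> A -> A) (nu : J -> J -> K) (I : A -> Prop).
Hypothesis L_lin : forall j, linear (L j).
Hypothesis R_lin : forall j, linear (R j).
Hypothesis nu_neq0 : forall i j, nu i j != 0.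
Hypothesis LR : forall i j u c,
  L j u = c *: R j u -> L j (R i u) = (c * nu j i) *: R j (R i u).
Hypothesis I_lin : forall a u v, I u -> I v -> I (a *: u + v).
Hypothesis I_L : forall j u, I u -> I (L j u).
Hypothesis I_R : forall j u, I u -> I (R j u).

Let lin_sum (f : A -> A) (s : seq P) (F : P -> A) :
  linear f -> f (\sum_(p <- s) F p) = \sum_(p <- s) f (F p).
Proof.
move=> lf; have f0 : f 0 = 0 by have := lf (-1) 0 0; rewrite scaler0 addr0 scaleN1r addNr.
by apply: (big_morph f) => // u v; have := lf 1 u v; rewrite !scale1r.
Qed.

(* If p is outside the class C, the operator L_j - chi p j R_j kills u p and
   acts on all of C as one nonzero multiple of R_j. *)
Lemma class_separation (s : seq P) (C : pred P) (u : P -> A) (chi : P -> J -> K)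
    (chi0 : J -> K) :
    (forall p j, p \in s -> L j (u p) = chi p j *: R j (u p)) ->
    (forall p j, p \in s -> C p -> chi p j = chi0 j) ->
    (forall p, p \in s -> ~~ C p -> exists j, chi p j != chi0 j) ->
    I (\sum_(p <- s) u p) ->
  exists w, I (\sum_(p <- s | C p) foldr R (u p) w).
Proof.
have [m] := ubnP (size s).
elim: m s u chi chi0 => // m IH s u chi chi0 le_m eig C1 C2 Is.
have [allC|] := boolP (all C s).
  exists [::]; rewrite big_seq_cond (eq_bigl (mem s)) -?big_seq // => p /=.
  by rewrite andb_idr // => /(allP allC).
case/allPn => p' p's nCp'; have [j chij] := C2 _ p's nCp'.
pose u' p := (chi p j - chi p' j) *: R j (u p).
pose s' := [seq p <- s | p != p'].
have sub p : p \in s' -> p \in s by rewrite mem_filter => /andP[].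
have RZ i a v : R i (a *: v) = a *: R i v.
  have R0 : R i 0 = 0 by have := R_lin i (-1) 0 0; rewrite scaler0 addr0 scaleN1r addNr.
  by have := R_lin i a v 0; rewrite R0 !addr0.
have LZ i a v : L i (a *: v) = a *: L i v.
  have L0 : L i 0 = 0 by have := L_lin i (-1) 0 0; rewrite scaler0 addr0 scaleN1r addNr.
  by have := L_lin i a v 0; rewrite L0 !addr0.
have [|||||w Iw] := IH s' u' (fun p i => chi p i * nu i j) (fun i => chi0 i * nu i j).
- rewrite -ltnS; apply: leq_trans le_m; rewrite ltnS size_filter ltn_neqAle -all_count.
  by rewrite count_size andbT; apply/allPn; exists p'; rewrite //= eqxx.
- move=> p i /sub ps; rewrite /u' LZ RZ (LR j (eig _ _ ps)) !scalerA.
  by rewrite mulrC.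
- by move=> p i /sub ps Cp; rewrite C1.
- move=> p /sub ps nCp; have [i chii] := C2 _ ps nCp; exists i.
  by apply: contraNneq chii => /(mulIf (nu_neq0 i j)) ->.
- have -> : \sum_(p <- s') u' p = - chi p' j *: R j (\sum_(p <- s) u p) + L j (\sum_(p <- s) u p).
    rewrite (lin_sum _ _ (R_lin j)) (lin_sum _ _ (L_lin j)) scaler_sumr -big_split /=.
    rewrite /s' big_filter big_mkcond /= !big_seq; apply: eq_bigr => p ps.
    rewrite eig // -scalerDl addrC /u'; case: eqP => [->|_] //=.
    by rewrite subrr scale0r.
  by apply: I_lin; [apply: I_R | apply: I_L].
(* [R j] acts before the operators of [w], hence sits innermost in the fold; on the class [C] it
   carries the common factor [kap], which is divided out. *)
exists (rcons w j); pose kap := chi0 j - chi p' j.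
have kap0 : kap != 0 by rewrite subr_eq0 eq_sym.
have -> : \sum_(p <- s | C p) foldr R (u p) (rcons w j)
        = kap^-1 *: (\sum_(p <- s' | C p) foldr R (u' p) w) + 0.
  rewrite addr0 /s' big_filter_cond scaler_sumr.
  rewrite big_seq_cond [RHS]big_seq_cond; apply: eq_big => [p|p /andP[ps Cp]].
    by case: (p \in s) => //=; case: eqP => [->|//]; rewrite (negPf nCp').
  rewrite foldr_rcons /u' C1 // -/kap.
  have foldZ : forall w a v, foldr R (a *: v) w = a *: foldr R v w.
    by elim=> [|i w' IHw] // a v /=; rewrite IHw RZ.
  by rewrite foldZ scalerA mulVf // scale1r.
have I0 : I 0 by have := I_lin (-1) Is Is; rewrite scaleN1r addNr.
exact: I_lin.
Qed.
End ClassSeparation.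

(** * Commutation up to scalars, ideals *)

Section QCommutation.
Context (K : fieldType) (A : algType K).
Implicit Types u v w : A.

(** Ideals do not see nonzero scalars, so reorderings are tracked up to this relation without
    recording the products of [lam] and [q] they produce. *)
Definition proportional u v := exists2 c : K, c != 0 & u = c *: v.
Definition qcomm u v := proportional (u * v) (v * u).

Lemma prop_refl u : proportional u u.
Proof. by exists 1; rewrite ?oner_neq0 ?scale1r. Qed.

Lemma prop_sym u v : proportional u v -> proportional v u.
Proof.
by case=> c c0 ->; exists c^-1; rewrite ?invr_neq0 // scalerA mulVf // scale1r.
Qed.

Lemma prop_trans v u w : proportional u v -> proportional v w -> proportional u w.
Proof. by case=> c c0 -> [d d0 ->]; exists (c * d); rewrite ?mulf_neq0 ?scalerA. Qed.

Lemma prop_mul u u' v v' :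
  proportional u u' -> proportional v v' -> proportional (u * v) (u' * v').
Proof.
case=> c c0 -> [d d0 ->]; exists (c * d); rewrite ?mulf_neq0 //.
by rewrite -scalerAl -scalerAr scalerA.
Qed.

Lemma prop_mull u v v' : proportional v v' -> proportional (u * v) (u * v').
Proof. exact/prop_mul/prop_refl. Qed.

Lemma prop_mulr u u' v : proportional u u' -> proportional (u * v) (u' * v).
Proof. by move=> h; apply: prop_mul h (prop_refl v). Qed.

Lemma qcomm_sym u v : qcomm u v -> qcomm v u.
Proof. exact: prop_sym. Qed.

Lemma qcomm_refl u : qcomm u u.
Proof. exact: prop_refl. Qed.

Lemma qcomm1 u : qcomm u 1.
Proof. by rewrite /qcomm mulr1 mul1r; apply: prop_refl. Qed.

Lemma qcommM u v w : qcomm u v -> qcomm u w -> qcomm u (v * w).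
Proof.
move=> uv uw; rewrite /qcomm mulrA; apply: prop_trans (prop_mulr w uv) _.
by rewrite -!mulrA; apply: prop_mull.
Qed.

Lemma qcommX u v m : qcomm u v -> qcomm u (v ^+ m).
Proof.
by move=> uv; elim: m => [|m IH]; rewrite ?expr0 ?exprS; [apply: qcomm1|apply: qcommM].
Qed.

Lemma qcomm_prod (T : Type) (s : seq T) (Q : pred T) (F : T -> A) u :
  (forall i, Q i -> qcomm u (F i)) -> qcomm u (\prod_(i <- s | Q i) F i).
Proof. by move=> h; apply: (big_ind (qcomm u)) => //; [apply: qcomm1|apply: qcommM]. Qed.

Lemma prod_extract (T : eqType) (s : seq T) (F : T -> A) i : uniq s -> i \in s ->
    (forall j, j != i -> qcomm (F j) (F i)) ->
  proportional (\prod_(j <- s) F j) (F i * \prod_(j <- s | j != i) F j).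
Proof.
move=> us is_ h; elim: s us is_ => // j s IH /= /andP[js us].
rewrite inE !big_cons => /predU1P[ij|iS].
  subst j; rewrite eqxx /= [X in proportional _ (_ * X)](_ : _ = \prod_(l <- s) F l).
    exact: prop_refl.
  rewrite big_seq_cond [RHS]big_seq; apply: eq_bigl => l.
  by case: (boolP (l \in s)) => //= ls; apply: contraNneq js => <-.
have ji : j != i by apply: contraNneq js => ->.
rewrite ji; apply: prop_trans (prop_mull _ (IH us iS)) _.
by rewrite !mulrA; apply/prop_mulr/h.
Qed.

(** Moving [s] past the copies of [t] one by one produces [be], [be * al], and so on, which add up
    to a q-number. Where this is nonzero, a twisted commutator with [s] lowers the power of [t] by
    one. *)
Lemma qcommutator_exp (s t : A) (al be : K) m : s * t = al *: (t * s) + be%:A ->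
  s * t ^+ m.+1 = al ^+ m.+1 *: (t ^+ m.+1 * s)
                  + (be * \sum_(i < m.+1) al ^+ i) *: t ^+ m.
Proof.
move=> st; elim: m => [|m IH].
  by rewrite big_ord1 !expr1 !expr0 mulr1.
have e1 : t ^+ m.+1 * (s * t) = al *: (t ^+ m.+2 * s) + be *: t ^+ m.+1.
  by rewrite st mulrDr -!scalerAr mulr1 mulrA -exprSr.
rewrite [t ^+ m.+2 in LHS]exprSr mulrA IH mulrDl -!scalerAl -[_ * s * t]mulrA e1 -!exprSr scalerDr !scalerA -addrA.
congr (_ *: _ + _); first by rewrite -exprSr.
by rewrite -scalerDl; congr (_ *: _); rewrite [in RHS]big_ord_recr /=; ring.
Qed.
End QCommutation.

(** * Two-sided ideals and primeness *)

Section Ideals.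
Context (K : fieldType) (A : algType K).
Implicit Types (I P : A -> Prop) (u v : A).

Lemma ideal0 I : ideal I -> I 0. Proof. by case. Qed.
Lemma ideal_add I u v : ideal I -> I u -> I v -> I (u + v).
Proof. by case=> _ h _; apply: h. Qed.
Lemma ideal_mull I a u : ideal I -> I u -> I (a * u).
Proof. by case=> _ _ h /(h a)[]. Qed.
Lemma ideal_mulr I a u : ideal I -> I u -> I (u * a).
Proof. by case=> _ _ h /(h a)[]. Qed.
Lemma ideal_scale I (c : K) u : ideal I -> I u -> I (c *: u).
Proof. by move=> hI Iu; rewrite -mulr_algl; apply: ideal_mull. Qed.
Lemma ideal_opp I u : ideal I -> I u -> I (- u).
Proof. by move=> hI Iu; rewrite -scaleN1r; apply: ideal_scale. Qed.
Lemma ideal_sub I u v : ideal I -> I u -> I v -> I (u - v).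
Proof. by move=> hI Iu Iv; apply: ideal_add => //; apply: ideal_opp. Qed.
Lemma ideal_prop I u v : ideal I -> proportional u v -> I u <-> I v.
Proof. by move=> hI uv; split; [case: (prop_sym uv)|case: uv] => c _ ->; apply: ideal_scale. Qed.
Lemma ideal_sum I (T : Type) (s : seq T) (Q : pred T) (F : T -> A) : ideal I ->
  (forall i, Q i -> I (F i)) -> I (\sum_(i <- s | Q i) F i).
Proof.
by move=> hI h; apply: (big_ind I) => //; [apply: ideal0|move=> u v; apply: ideal_add].
Qed.
Lemma ideal_congr I u v : ideal I -> I (u - v) -> I u <-> I v.
Proof.
move=> hI uv; split=> h; last by rewrite -(subrK v u); apply: ideal_add.
by rewrite -(subKr u v); apply: ideal_sub.
Qed.

Lemma gen_ideal_ideal u : ideal (gen_ideal u).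
Proof.
split=> [I hI _|v w hv hw I hI Iu|a v hv]; first exact: ideal0.
  by apply: ideal_add => //; [apply: hv|apply: hw].
by split=> I hI Iu; [apply: ideal_mull|apply: ideal_mulr] => //; apply: hv.
Qed.

Lemma ideal_zero : ideal (fun u : A => u = 0).
Proof. by split=> // [u v -> ->|a u ->]; rewrite ?addr0 ?mulr0 ?mul0r. Qed.

Lemma ideal_preim (B : algType K) (f : A -> B) (N : B -> Prop) :
  alg_hom f -> ideal N -> ideal (fun u => N (f u)).
Proof.
move=> [fl f1 fM] [N0 ND NM].
have fD u v : f (u + v) = f u + f v by have := fl 1 u v; rewrite !scale1r.
have f0 : f 0 = 0 by have := fl (-1) 0 0; rewrite scaler0 addr0 scaleN1r addNr.
split=> [|u v|a u]; first by rewrite f0.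
  by rewrite fD; apply: ND.
by rewrite !fM; apply: NM.
Qed.

(** Primeness is later tested one factor at a time: monomials in the [z_i] are sought in this ideal
    and then in its mirror image [ideal_rannul]. *)
Lemma ideal_lannul P v : ideal P -> ideal (fun u => forall r, P (u * r * v)).
Proof.
move=> hP; split=> [r|u w hu hw r|a u hu]; first by rewrite !mul0r; apply: ideal0.
  by rewrite !mulrDl; apply: ideal_add.
split=> r; last by rewrite -(mulrA u).
by rewrite -!mulrA; apply: ideal_mull; rewrite // mulrA.
Qed.

Lemma ideal_rannul P u : ideal P -> ideal (fun v => forall r, P (u * r * v)).
Proof.
move=> hP; split=> [r|v w hv hw r|a v hv]; first by rewrite mulr0; apply: ideal0.
  by rewrite mulrDr; apply: ideal_add.
split=> r; first by rewrite mulrA -(mulrA u).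
by rewrite mulrA; apply: ideal_mulr.
Qed.

(** For the forward direction, [J] is everything that [I] multiplies into [P], so the product
    condition holds by construction; [u] lies in [I] by assumption and [v] in [J] by taking
    [r = 1]. *)
Lemma prime_idealP P : ideal P -> ~ P 1 ->
  prime_ideal P <-> forall u v, (forall r, P (u * r * v)) -> P u \/ P v.
Proof.
move=> hP P1; split=> [[_ _ prP] u v uv|h]; last first.
  split=> // I J hI hJ IJ; case: (pselect (forall a, I a -> P a)); first by left.
  move=> /existsNP[a /not_implyP[Ia Pa]]; right=> b Jb.
  by have [//|//] := h a b (fun r => IJ _ _ (ideal_mulr r hI Ia) Jb).
pose I a := forall r, P (a * r * v).
pose J b := forall a, I a -> P (a * b).
have hI : ideal I by apply: ideal_lannul.
have [||a b Ia Jb|h|h] := prP I J.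
- exact: hI.
- split=> [a _|b c hb hc a Ia|r b hb].
  + by rewrite mulr0; apply: ideal0.
  + by rewrite mulrDr; apply: ideal_add; [|apply: hb|apply: hc].
  + split=> a Ia; first by rewrite mulrA; apply: hb; apply: (ideal_mulr r hI Ia).
    by rewrite mulrA; apply: ideal_mulr => //; apply: hb.
- exact: Jb.
- by left; apply: h.
- by right; apply: h => a Ia; have := Ia 1; rewrite mulr1.
Qed.
End Ideals.

(** * Finite lists of terms *)

Lemma seq_max (T : eqType) (f : T -> int) (s : seq T) : s != [::] ->
  exists2 p, p \in s & forall r, r \in s -> (f r <= f p)%R.
Proof.
elim: s => // p s IH _; have [->|/IH[r rs rmax]] := eqVneq s [::].
  by exists p => [|r]; rewrite ?mem_head // inE => /eqP ->.
have [pr|rp] := Order.TotalTheory.leP (f p) (f r).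
  exists r; first by rewrite inE rs orbT.
  by move=> t; rewrite inE => /predU1P[->|/rmax].
exists p; first exact: mem_head.
move=> t; rewrite inE => /predU1P[->|/rmax] //.
by move=> /Order.POrderTheory.le_trans; apply; apply: Order.POrderTheory.ltW.
Qed.

(** Terms with the same index may repeat and cancel. If the coefficients at the index of the head
    sum to zero, that class contributes nothing and is removed; as the total is nonzero, some class
    must survive. *)
Lemma class_coef_neq0 (K : fieldType) (A : lmodType K) (T : eqType) (M : T -> A)
    (s : seq (K * T)) : \sum_(p <- s) p.1 *: M p.2 != 0 ->
  exists p0, p0 \in [seq p.2 | p <- s] /\ \sum_(p <- s | p.2 == p0) p.1 != 0.
Proof.
have [m] := ubnP (size s); elim: m s => // m IH [|p0 s] /= le_m.
  by rewrite big_nil eqxx.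
set t := p0 :: s; have [c0|c0] := eqVneq (\sum_(p <- t | p.2 == p0.2) p.1) 0; last first.
  by move=> _; exists p0.2; rewrite mem_head.
pose t' := [seq p <- t | p.2 != p0.2].
rewrite (bigID (fun p : K * T => p.2 == p0.2)) /=.
rewrite (eq_bigr (fun p => p.1 *: M p0.2)); last by move=> p /eqP ->.
rewrite -scaler_suml c0 scale0r add0r -big_filter => /IH[].
  rewrite /= eqxx /= ltnS in le_m *; apply: leq_ltn_trans le_m.
  by rewrite size_filter count_size.
move=> p1 [/mapP[p pt ->]]; rewrite -/t'; move: pt; rewrite mem_filter => /andP[pp0 pt] cp.
exists p.2; split; first exact: (map_f (fun p => p.2) pt).
move: cp; rewrite big_filter_cond; congr (_ != 0); apply: eq_bigl => p' /=.
by case: (eqVneq p'.2 p.2) => [->|]; rewrite ?andbF ?andbT.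
Qed.

(** * The quantized Weyl algebra *)

Section Eigen.
Context (K : fieldType) (A : algType K).
Implicit Types (u v : A) (c : K).

Lemma eigen_expr u v c m : u * v = c *: (v * u) -> u * v ^+ m = c ^+ m *: (v ^+ m * u).
Proof.
move=> uv; elim: m => [|m IH]; first by rewrite !expr0 scale1r mulr1 mul1r.
by rewrite !exprS mulrA uv -scalerAl -[v * u * _]mulrA IH -scalerAr scalerA [v * (_ * u)]mulrA.
Qed.

Lemma eigen_expl u v c m : u * v = c *: (v * u) -> u ^+ m * v = c ^+ m *: (v * u ^+ m).
Proof.
move=> uv; elim: m => [|m IH]; first by rewrite !expr0 scale1r mulr1 mul1r.
by rewrite exprSr -mulrA uv -scalerAr [_ * (v * u)]mulrA IH -scalerAl scalerA -exprS -mulrA -exprSr.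
Qed.

Lemma eigen_prodr (T : Type) (s : seq T) (Q : pred T) u (F : T -> A) (c : T -> K) :
    (forall i, Q i -> u * F i = c i *: (F i * u)) ->
  u * \prod_(i <- s | Q i) F i = (\prod_(i <- s | Q i) c i) *: (\prod_(i <- s | Q i) F i * u).
Proof.
move=> h; elim: s => [|i s IH]; first by rewrite !big_nil scale1r mulr1 mul1r.
rewrite !big_cons; case: ifP => // Qi.
by rewrite mulrA h // -scalerAl -[F i * u * _]mulrA IH -scalerAr scalerA mulrA.
Qed.

Lemma eigen_prodl (T : Type) (s : seq T) (Q : pred T) u (F : T -> A) (c : T -> K) :
    (forall i, Q i -> F i * u = c i *: (u * F i)) ->
  (\prod_(i <- s | Q i) F i) * u = (\prod_(i <- s | Q i) c i) *: (u * \prod_(i <- s | Q i) F i).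
Proof.
move=> h; elim: s => [|i s IH]; first by rewrite !big_nil scale1r mulr1 mul1r.
rewrite !big_cons; case: ifP => // Qi.
by rewrite -mulrA IH -scalerAr [F i * (u * _)]mulrA h // -scalerAl scalerA mulrA (mulrC (c i)).
Qed.

Lemma prod_commM (T : Type) (s : seq T) (F G : T -> A) :
    (forall i j, GRing.comm (F i) (G j)) ->
  (\prod_(i <- s) F i) * (\prod_(i <- s) G i) = \prod_(i <- s) (F i * G i).
Proof.
move=> h; elim: s => [|i s IH]; first by rewrite !big_nil mulr1.
rewrite !big_cons -IH -!mulrA; congr (_ * _); rewrite !mulrA; congr (_ * _).
by apply/commr_sym/commr_prod => j _; apply: commr_sym.
Qed.
End Eigen.

Section QWeyl.
Context (K : fieldType) (n : nat) (q : 'I_n -> K) (lam : 'I_n -> 'I_n -> K).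
Hypothesis hq0 : forall i, q i != 0.
Hypothesis hqroot : forall i (k : nat), (0 < k)%N -> q i ^+ k != 1.
Hypothesis hlam0 : forall i j, lam i j != 0.
Hypothesis hlaminv : forall i j, lam i j = (lam j i)^-1.
Context (A : algType K) (x y : 'I_n -> A).
Hypothesis hA : is_qweyl_algebra q lam x y.

Let q_sub1 i : q i - 1 != 0.
Proof. by rewrite subr_eq0; have := @hqroot i 1%N isT; rewrite expr1. Qed.

(** * Relations between the generators and the [z_i] *)

Definition zel i : A := x i * y i - y i * x i.
Local Notation z := zel.

Definition gen (b : bool) i := if b then x i else y i.
(* The q-commutation factor of gen b i both with z_i and with gen (~~ b) i. *)
Definition alpha (b : bool) i : K := if b then (q i)^-1 else q i.

Lemma alpha_neq0 b i : alpha b i != 0.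
Proof. by case: b; rewrite /alpha ?invr_neq0. Qed.

Lemma alpha_pow_neq1 b i k : (0 < k)%N -> alpha b i ^+ k != 1.
Proof. by move=> k0; case: b; rewrite /alpha ?exprVn ?invr_eq1 hqroot. Qed.

Lemma expz_q_inj i : injective (fun d : int => q i ^ d).
Proof.
move=> d e /eqP; rewrite -subr_eq0 => /eqP h; apply/eqP; rewrite -subr_eq0.
have : q i ^ (d - e) = 1.
  by move/eqP: h; rewrite subr_eq0 => /eqP h; rewrite expfzDr // -invr_expz h divff // expfz_neq0.
case: (d - e) => [[|m]|m] //= /eqP; first by rewrite -exprnP (negPf (hqroot _ _)).
by rewrite NegzE -exprnN invr_eq1 (negPf (hqroot _ _)).
Qed.

Lemma xyE i : x i * y i = 1 + q i *: (y i * x i).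
Proof. by case: hA => [[_ /(_ i) <-] _]; rewrite subrK. Qed.

Lemma zE i : z i = 1 + (q i - 1) *: (y i * x i).
Proof. by rewrite /z xyE scalerBl scale1r addrA. Qed.

Lemma z_gen b i : z i * gen b i = alpha b i *: (gen b i * z i).
Proof.
case: b; rewrite /= zE mulrDl mulrDr mul1r mulr1 -scalerAl -scalerAr.
  rewrite (mulrA (x i)) xyE mulrDl mul1r -scalerAl !scalerDr !scalerA addrA -scalerDl.
  congr (_ + _ *: _); last by field; rewrite hq0.
  by rewrite [X in X *: _](_ : _ = 1) ?scale1r //; field; rewrite hq0.
rewrite -(mulrA (y i)) xyE mulrDr mulr1 -!scalerAr !scalerDr !scalerA addrA.
rewrite -{1}[y i]scale1r -scalerDl; congr (_ *: _ + _ *: _); first by rewrite addrC subrK.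
by rewrite mulrC.
Qed.

Lemma gen_qcomm b b' i j : i != j -> qcomm (gen b i) (gen b' j).
Proof.
have [hlt _] : qweyl_rel q lam x y := proj1 hA.
wlog ij : b b' i j / (i < j)%N => [hw|] ij'.
  have [|ji|/val_inj ij] := ltngtP i j; first by move=> ?; apply: hw.
    by apply/qcomm_sym/hw; rewrite // eq_sym.
  by rewrite ij eqxx in ij'.
have [h1 h2 h3 h4] := hlt i j ij.
case: b; case: b'; [|by exists (lam j i)| |]; first by exists (lam i j).
  by apply: qcomm_sym; exists (lam i j).
by apply: qcomm_sym; exists (lam j i).
Qed.

(** Past a generator of index [j], [x_i] and [y_i] pick up inverse scalars, which cancel in both
    products making up [z_i]. *)
Lemma z_gen_neq b i j : i != j -> z i * gen b j = gen b j * z i.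
Proof.
move=> ij; have [hlt _] : qweyl_rel q lam x y := proj1 hA.
suff [c [c0 hx hy]] : exists c : K, [/\ c != 0, x i * gen b j = c *: (gen b j * x i)
    & y i * gen b j = c^-1 *: (gen b j * y i)].
  rewrite /z mulrBl mulrBr -!mulrA hx hy -!scalerAr !mulrA hx hy -!scalerAl !scalerA.
  by rewrite mulVf // mulfV // !scale1r.
have [ij'|ji'|/val_inj ij'] := ltngtP i j; last by rewrite ij' eqxx in ij.
- have [h1 h2 h3 h4] := hlt i j ij'; case: b.
    exists (lam i j); split=> //=.
    by rewrite /= h4 scalerA mulVf ?scale1r.
  exists (lam j i); split=> //=.
  by rewrite /= h2 scalerA mulVf ?scale1r.
- have [h1 h2 h3 h4] := hlt j i ji'; case: b.
    exists (lam i j); split=> //=; first by rewrite h1 scalerA (hlaminv i j) mulVf ?scale1r.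
    by rewrite h3 scalerA mulVf ?scale1r.
  exists (lam j i); split=> //=.
  by rewrite h2 -hlaminv.
Qed.

Lemma z_comm i j : GRing.comm (z i) (z j).
Proof.
have [->|ij] := eqVneq i j; first exact: commr_refl.
have hx : GRing.comm (z i) (x j) := z_gen_neq true ij.
have hy : GRing.comm (z i) (y j) := z_gen_neq false ij.
by apply: commrB; apply: commrM.
Qed.

(** The constant term of the q-commutator of the two generators of index [i]; it is nonzero for both
    values of [b], which later permits division by it. *)
Definition beta (b : bool) i : K := if b then - (q i)^-1 else 1.

Lemma gen_gen b i :
  gen (~~ b) i * gen b i = alpha b i *: (gen b i * gen (~~ b) i) + (beta b i)%:A.
Proof.
case: b => /=; last by rewrite xyE addrC scale1r.
by rewrite xyE scalerDr scalerA mulVf // scale1r addrAC -scalerDl subrr scale0r add0r.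
Qed.

Lemma gen_gen_z b i : exists a0 a1, gen b i * gen (~~ b) i = a1 *: z i + a0%:A.
Proof.
have yx : y i * x i = (q i - 1)^-1 *: z i + (- (q i - 1)^-1)%:A.
  by rewrite zE scalerDr scalerA mulVf // scale1r addrAC -scalerDl subrr scale0r add0r.
case: b => /=; last by exists (- (q i - 1)^-1), (q i - 1)^-1.
exists (1 - q i * (q i - 1)^-1), (q i * (q i - 1)^-1).
by rewrite xyE yx scalerDr !scalerA addrCA mulrN scaleNr scalerBl scale1r.
Qed.

(** * Monomials and their commutation rules *)

Definition zmon (k : 'I_n -> nat) : A := \prod_(j < n) z j ^+ k j.

Lemma zmonD k l : zmon k * zmon l = zmon (fun j => k j + l j)%N.
Proof.
rewrite /zmon prod_commM; first by apply: eq_bigr => j _; rewrite exprD.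
by move=> i j; apply/commrX/commr_sym/commrX/z_comm.
Qed.

Lemma zmon0 : zmon (fun=> 0%N) = 1.
Proof. by rewrite /zmon big1 // => j _; rewrite expr0. Qed.

Lemma zmon1 i : zmon (fun j => (j == i) : nat) = z i.
Proof.
rewrite /zmon (eq_bigr (fun j => if j == i then z j else 1)).
  by rewrite -big_mkcond big_pred1_eq.
by move=> j _; case: eqP; rewrite ?expr1 ?expr0.
Qed.

Lemma zmon_gen b j k : zmon k * gen b j = alpha b j ^+ k j *: (gen b j * zmon k).
Proof.
rewrite /zmon (@eigen_prodl _ _ _ _ _ _ _ (fun i => if i == j then alpha b j ^+ k j else 1)).
  by rewrite -big_mkcond big_pred1_eq.
move=> i _; case: eqP => [->|/eqP ij]; first exact/eigen_expl/z_gen.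
by rewrite scale1r; apply/commr_sym/commrX/commr_sym/z_gen_neq.
Qed.

Definition tmon (b : 'I_n -> bool) (m : 'I_n -> nat) : A :=
  \prod_(j < n) gen (b j) j ^+ m j.

(** Isolates the factors that q-commute with both generators of index [i] and are untouched by the
    inhomogeneous relation at [i]. *)
Definition tmon' i (b : 'I_n -> bool) (m : 'I_n -> nat) : A :=
  \prod_(j < n | j != i) gen (b j) j ^+ m j.

Lemma tmon_extract i b m :
  proportional (tmon b m) (gen (b i) i ^+ m i * tmon' i b m).
Proof.
apply: prod_extract; rewrite ?index_enum_uniq ?mem_index_enum // => j ji.
by apply/qcommX/qcomm_sym/qcommX/gen_qcomm; rewrite eq_sym.
Qed.

Lemma tmon_qcomm i b m : qcomm (gen (b i) i) (tmon b m).
Proof.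
apply: qcomm_prod => j _; apply: qcommX.
by have [->|ji] := eqVneq i j; [apply: qcomm_refl|apply: gen_qcomm].
Qed.

Lemma tmon'_qcomm b' i b m : qcomm (gen b' i) (tmon' i b m).
Proof. by apply: qcomm_prod => j ji; apply/qcommX/gen_qcomm; rewrite eq_sym. Qed.

Lemma z_tmon i b m : z i * tmon b m = alpha (b i) i ^+ m i *: (tmon b m * z i).
Proof.
rewrite /tmon (@eigen_prodr _ _ _ _ _ _ _ (fun j => if j == i then alpha (b i) i ^+ m i else 1)).
  by rewrite -big_mkcond big_pred1_eq.
move=> j _; case: eqP => [->|/eqP ij]; first exact/eigen_expr/z_gen.
by rewrite scale1r; apply/commrX/z_gen_neq; rewrite eq_sym.
Qed.

Lemma z_tmon' i b m : z i * tmon' i b m = tmon' i b m * z i.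
Proof. by apply: commr_prod => j ij; apply/commrX/z_gen_neq; rewrite eq_sym. Qed.

(** Finite functions have decidable equality, needed to group terms by index. *)
Definition idx := ({ffun 'I_n -> int} * {ffun 'I_n -> nat})%type.
Definition tdeg (d : 'I_n -> int) : A := tmon (fun j => (d j < 0)%R) (fun j => absz (d j)).
Definition mon (p : idx) : A := tdeg p.1 * zmon p.2.

Lemma alpha_expz i (d : int) : alpha (d < 0)%R i ^+ absz d = q i ^ d.
Proof. by case: d => m //=; rewrite /alpha exprVn NegzE -exprnN. Qed.

Lemma z_mon i p : z i * mon p = q i ^ (p.1 i) *: (mon p * z i).
Proof.
rewrite /mon mulrA z_tmon alpha_expz -scalerAl -!mulrA; congr (_ *: (_ * _)).
by apply: commr_prod => j _; apply/commrX/z_comm.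
Qed.

Lemma eq_zmon k l : k =1 l -> zmon k = zmon l.
Proof. by move=> kl; apply: eq_bigr => j _; rewrite kl. Qed.

Lemma alpha_pow_inj b i : injective (fun m : nat => alpha b i ^+ m).
Proof.
suff le_inj m m' : (m <= m')%N -> alpha b i ^+ m = alpha b i ^+ m' -> m = m'.
  move=> m m' /= h; have [mm'|/ltnW mm'] := leqP m m'; first exact: le_inj.
  by apply/esym/le_inj.
move=> le_mm'; rewrite -{1}(subnK le_mm') exprD -{1}[_ ^+ m]mul1r.
move/(mulIf (expf_neq0 _ (alpha_neq0 b i)))/esym/eqP => h.
apply/eqP; rewrite eqn_leq le_mm' -subn_eq0 /= -leqn0 leqNgt.
by apply: contraL h => /alpha_pow_neq1 ->.
Qed.

(** * Spanning by monomials *)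

Definition msum (s : seq (K * idx)) : A := \sum_(p <- s) p.1 *: mon p.2.

Lemma gen_gen_exp b i m : exists a0 a1,
  gen b i * gen (~~ b) i ^+ m.+1 = gen (~~ b) i ^+ m * (a1 *: z i + a0%:A).
Proof.
have [a0 [a1 e]] := gen_gen_z b i; exists a0, (a1 * alpha (~~ b) i ^+ m).
rewrite exprS mulrA e mulrDl mulrDr -!scalerAl -!scalerAr mul1r mulr1.
by rewrite (eigen_expr _ (z_gen (~~ b) i)) scalerA.
Qed.

(** The degree moves by one. Moving towards 0 creates a product of opposite generators, which is
    affine in [z_i]; otherwise the affine factor is 1. *)
Lemma gen_tpow b i (d : int) : exists d' a0 a1,
  gen b i * gen (d < 0)%R i ^+ absz d
  = gen (d' < 0)%R i ^+ absz d' * (a1 *: z i + a0%:A).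
Proof.
case: d => m; case: b => /=.
- case: m => [|m].
    by exists (Negz 0), 1, 0; rewrite /= scale0r add0r scale1r expr0 !mulr1.
  by have [a0 [a1 e]] := gen_gen_exp true i m; exists (Posz m), a0, a1.
- by exists (Posz m.+1), 1, 0; rewrite /= scale0r add0r scale1r mulr1 exprS.
- by exists (Negz m.+1), 1, 0; rewrite /= scale0r add0r scale1r mulr1 -exprS.
- have [a0 [a1 e]] := gen_gen_exp false i m; case: m e => [|m] e.
    by exists (Posz 0), a0, a1.
  by exists (Negz m), a0, a1.
Qed.

Lemma gen_mon b i p : exists s, gen b i * mon p = msum s.
Proof.
case: p => d k; have [d' [a0 [a1 e]]] := gen_tpow b i (d i).
(* Only coordinate [i] of the degree changes. The new [z_i] commutes with the factors of [tmon'] and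
   is absorbed into [k2]. *)
pose d2 := [ffun j => if j == i then d' else d j].
pose k2 := [ffun j => ((j == i) + k j)%N].
have [c _ cE] := tmon_extract i (fun j => (d j < 0)%R) (fun j => absz (d j)).
have [c2 _ c2E] := prop_sym (tmon_extract i (fun j => (d2 j < 0)%R) (fun j => absz (d2 j))).
have tE : tmon' i (fun j => (d2 j < 0)%R) (fun j => absz (d2 j))
        = tmon' i (fun j => (d j < 0)%R) (fun j => absz (d j)).
  by apply: eq_bigr => j /negPf ji; rewrite ffunE ji.
rewrite tE /d2 ffunE eqxx -/d2 in c2E.
exists [:: (c * (a1 * c2), (d2, k2)); (c * (a0 * c2), (d2, k))].
rewrite /msum !big_cons big_nil addr0 /mon /= /tdeg cE.
rewrite -scalerAl -scalerAr !mulrA e -!scalerA -scalerDr; congr (_ *: _).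
rewrite mulrDr !mulrDl -!scalerAr mulr1 -!scalerAl; congr (_ *: _ + _ *: _); last first.
  by rewrite c2E scalerAl.
have -> : zmon k2 = z i * zmon k.
  by rewrite -zmon1 zmonD; apply: eq_zmon => j; rewrite ffunE.
by rewrite -(mulrA _ (z i)) z_tmon' !mulrA c2E !scalerAl.
Qed.

Lemma msumD s t : msum s + msum t = msum (s ++ t).
Proof. by rewrite /msum big_cat. Qed.

Lemma msumZ a s : a *: msum s = msum [seq (a * p.1, p.2) | p <- s].
Proof. by rewrite /msum big_map scaler_sumr; apply: eq_bigr => p _; rewrite scalerA. Qed.

(** The elements whose left multiplication preserves the span form a subalgebra containing the
    generators, hence are all of [A]; applying [u] to the monomial 1 then puts [u] in the span. *)
Lemma msum_span u : exists s, u = msum s.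
Proof.
pose S v := forall s, exists t, v * msum s = msum t.
have gen_S b i : S (gen b i).
  elim=> [|[a p] s [t IH]]; first by exists [::]; rewrite /msum !big_nil mulr0.
  have [t' e] := gen_mon b i p.
  exists ([seq (a * r.1, r.2) | r <- t'] ++ t).
  by rewrite -msumD -msumZ -e -IH {1}/msum big_cons -/(msum s) mulrDr -scalerAr.
have /(_ u)/(_ [:: (1, ([ffun=> 0], [ffun=> 0%N]))])[t e] : forall v, S v.
  apply: (qweyl_generated hA) => [|i|i]; [|exact: gen_S true i|exact: gen_S false i].
  split=> [|a v w /asboolP hv /asboolP hw|v w /asboolP hv /asboolP hw]; apply/asboolP => s.
  - by exists s; rewrite mul1r.
  - have [t e] := hv s; have [t' e'] := hw s.
    by exists ([seq (a * r.1, r.2) | r <- t] ++ t'); rewrite -msumD -msumZ mulrDl -scalerAl e e'.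
  - by have [t e] := hw s; rewrite -mulrA e.
exists t; rewrite -e /msum big_seq1 scale1r /mon /=.
rewrite (@eq_zmon _ (fun=> 0%N)) ?zmon0; last by move=> j; rewrite ffunE.
by rewrite /tdeg /tmon big1 ?mulr1 // => j _; rewrite ffunE expr0.
Qed.

(** * From an ideal element to a monomial in the [z_i] *)

(** Induction on the total exponent. The generator [s] opposite to [t] q-commutes with the remaining
    factors [w], so a twisted commutator of [s] with [t^(r+1) w] is a nonzero multiple of
    [t^r w]. *)
Lemma tmon_remove I b m k : ideal I -> I (tmon b m * zmon k) -> I (zmon k).
Proof.
move=> hI; have [N] := ubnP (\sum_j m j)%N; elim: N m => // N IH m le_N Im.
have [j mj|m0] := pickP (fun j => m j != 0%N); last first.
  have t1 : tmon b m = 1.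
    by rewrite /tmon big1 // => j _; have /negbFE/eqP -> := m0 j; rewrite expr0.
  by rewrite t1 mul1r in Im.
pose m' i := if i == j then (m j).-1 else m i.
have tE : tmon' j b m' = tmon' j b m.
  by apply: eq_bigr => i /negPf ij; rewrite /m' ij.
have mjE : m j = (m j).-1.+1 by rewrite prednK // lt0n.
apply: (IH m').
  rewrite -ltnS; apply: leq_trans le_N; rewrite ltnS (bigD1 j) //= [in X in (_ < X)%N](bigD1 j) //=.
  rewrite {1}/m' eqxx {2}mjE addSn ltnS leq_add2l; apply: eq_leq.
  by apply: eq_bigr => i /negPf ij; rewrite /m' ij.
set t := gen (b j) j; set s := gen (~~ b j) j; set r := (m j).-1.
pose w := tmon' j b m * zmon k.
have Iw : I (t ^+ r.+1 * w).
  by move: Im; rewrite mulrA -mjE; apply: (ideal_prop hI (prop_mulr _ (tmon_extract j b m))).1.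
suff Iw' : I (t ^+ r * w).
  move: Iw'; rewrite mulrA -tE.
  apply: (ideal_prop hI (prop_mulr _ (prop_sym _))).1.
  by have := tmon_extract j b m'; rewrite {2}/m' eqxx.
have [eta eta0 sw] : qcomm s w.
  apply: qcommM; first exact: tmon'_qcomm.
  by apply: qcomm_sym; exists (alpha (~~ b j) j ^+ k j); rewrite ?expf_neq0 ?alpha_neq0 ?zmon_gen.
pose al := alpha (b j) j; pose ga := beta (b j) j * \sum_(i < r.+1) al ^+ i.
(* The geometric sum times [al - 1] is [al^(r+1) - 1], nonzero because [al] is not a root of
   unity. *)
have ga0 : ga != 0.
  rewrite mulf_neq0 //; first by rewrite /beta; case: (b j); rewrite ?oppr_eq0 ?invr_eq0 ?oner_eq0.
  have := alpha_pow_neq1 (b j) j (ltn0Sn r); rewrite -subr_eq0 subrX1 mulf_eq0 negb_or.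
  by case/andP.
have e : ga *: (t ^+ r * w) = s * (t ^+ r.+1 * w) - (al ^+ r.+1 * eta) *: (t ^+ r.+1 * w * s).
  rewrite (mulrA s) (qcommutator_exp r (gen_gen (b j) j)) -/t -/s mulrDl -!scalerAl.
  rewrite -(mulrA _ s w) -(mulrA _ w s) sw.
  by rewrite -scalerAr scalerA -/al [RHS]addrAC subrr add0r.
rewrite -[_ * _]scale1r -(mulVf ga0) -scalerA e; apply: ideal_scale => //.
exact: ideal_sub hI (ideal_mull s hI Iw) (ideal_scale _ hI (ideal_mulr s hI Iw)).
Qed.

Lemma gen_tmon b i m :
  proportional (gen (b i) i * tmon b m) (tmon b (fun j => (j == i) + m j)%N).
Proof.
apply: prop_trans (prop_mull _ (tmon_extract i b m)) _; apply: prop_sym.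
apply: prop_trans (tmon_extract i b _) _; rewrite eqxx exprS mulrA.
rewrite [X in proportional _ (_ * X)](_ : _ = tmon' i b (fun j => (j == i) + m j)%N).
  exact: prop_refl.
by apply: eq_bigr => j /negPf ->.
Qed.

(** The price of separating degrees: every term is multiplied by the same monomial in the [z_j],
    with active indices only. *)
Lemma foldr_z (act : pred 'I_n) (w : seq {j | act j}) : exists k,
  (forall j, ~~ act j -> k j = 0%N) /\
  forall u, foldr (fun (j : {j | act j}) u => u * z (val j)) u w = u * zmon k.
Proof.
elim: w => [|j w [k [k0 IH]]]; first by exists (fun=> 0%N); split=> // u; rewrite zmon0 mulr1.
exists (fun i => (k i + (i == val j))%N); split=> [i ai|u /=].
  by rewrite k0 //; case: eqP => // ij; rewrite ij (valP j) in ai.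
by rewrite IH -mulrA -(zmon1 (val j)) zmonD.
Qed.

(** The price of separating exponents: up to a scalar only the powers in the t-part change, and
    [tmon_remove] strips these anyway. *)
Lemma foldr_t (act : pred 'I_n) (b : 'I_n -> bool) m k (w : seq {j | act j}) : exists m',
  proportional (foldr (fun (j : {j | act j}) u => u * gen (b (val j)) (val j))
                  (tmon b m * zmon k) w)
               (tmon b m' * zmon k).
Proof.
elim: w => [|j w [m' IH]]; first by exists m; apply: prop_refl.
exists (fun i => (i == val j) + m' i)%N.
apply: prop_trans (prop_mulr _ IH) _; apply: prop_sym.
apply: prop_trans (prop_mulr _ (prop_sym (gen_tmon b (val j) m'))) _.
apply: prop_trans (prop_mulr _ (tmon_qcomm (val j) b m')) _.
rewrite -!mulrA; apply/prop_mull/qcomm_sym.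
by exists (alpha (b (val j)) (val j) ^+ k (val j)); rewrite ?expf_neq0 ?alpha_neq0 ?zmon_gen.
Qed.

(* Conjugation by the z_j separates the degrees d, then conjugation by the t_j
   separates the exponents k; only indices in act are used for this, so the
   exponents outside act survive unchanged. *)
Lemma monomial_in_ideal (act : pred 'I_n) (I : A -> Prop) (s : seq (K * idx)) (d0 : {ffun 'I_n -> int})
    (k0 : {ffun 'I_n -> nat}) : ideal I ->
    (forall p j, p \in s -> ~~ act j -> p.2.1 j = d0 j /\ p.2.2 j = k0 j) ->
    I (msum s) -> \sum_(p <- s | p.2 == (d0, k0)) p.1 != 0 ->
  exists k, (forall j, ~~ act j -> k j = k0 j) /\ I (zmon k).
Proof.
move=> hI hs Is cs.
have I_lin a u v : I u -> I v -> I (a *: u + v).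
  by move=> Iu Iv; apply: ideal_add => //; apply: ideal_scale.
have mull_lin (a : A) : linear (fun u => a * u).
  by move=> c u v; rewrite mulrDr scalerAr.
have mulr_lin (a : A) : linear (fun u => u * a).
  by move=> c u v; rewrite mulrDl scalerAl.
pose C1 (p : K * idx) := p.2.1 == d0.
have [w1 Iw1] : exists w, I (\sum_(p <- s | C1 p)
    foldr (fun (j : {j | act j}) u => u * z (val j)) (p.1 *: mon p.2) w).
  apply: (@class_separation K A {j | act j} _ (fun j u => z (val j) * u)
     (fun j u => u * z (val j)) (fun _ _ => 1) I _ _ _ _ _ _ _ s C1
     (fun p => p.1 *: mon p.2) (fun p j => q (val j) ^ p.2.1 (val j))
     (fun j => q (val j) ^ d0 (val j))) => //.
  - by move=> i j; apply: oner_neq0.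
  - by move=> i j u c h; rewrite mulrA h mulr1 -scalerAl -!mulrA z_comm.
  - by move=> j u Iu; apply: ideal_mull.
  - by move=> j u Iu; apply: ideal_mulr.
  - by move=> p j ps; rewrite -scalerAr z_mon -scalerAl !scalerA mulrC.
  - by move=> p j ps /eqP ->.
  (* All terms agree with [d0] outside [act], so a differing degree occurs at an active index, where
     [z_j] detects it. *)
  - move=> p ps; case: (pselect (exists j, p.2.1 j != d0 j)); last first.
      by move=> h /eqP[]; apply/ffunP => j; apply/eqP; apply: contrapT => /negP hj; apply: h; exists j.
    case=> j hj _; have aj : act j.
      by apply: contraNT hj => aj; rewrite (proj1 (hs p j ps aj)).
    by exists (exist _ j aj); apply: contraNneq hj => /= /expz_q_inj ->.
have [k1 [k10 k1E]] := foldr_z w1.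
pose b j := (d0 j < 0)%R.
pose s1 := [seq p <- s | C1 p].
pose t (j : 'I_n) := gen (b j) j.
have [nu hnu] : exists nu : 'I_n -> 'I_n -> K, forall i j, nu i j != 0 /\ t i * t j = nu i j *: (t j * t i).
  have h i : exists f : 'I_n -> K, forall j, f j != 0 /\ t i * t j = f j *: (t j * t i).
    have hc j : exists c : K, c != 0 /\ t i * t j = c *: (t j * t i).
      have [c c0 e] : qcomm (t i) (t j); last by exists c.
      by have [->|ij] := eqVneq i j; [apply: qcomm_refl|apply: gen_qcomm].
    by have [f hf] := choice hc; exists f.
  by have [f hf] := choice h; exists f.
have [mu hmu] : exists mu : 'I_n -> K,
    forall j, mu j != 0 /\ t j * tdeg d0 = mu j *: (tdeg d0 * t j).
  have hc j : exists c : K, c != 0 /\ t j * tdeg d0 = c *: (tdeg d0 * t j).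
    by have [c c0 e] := tmon_qcomm j b (fun j => absz (d0 j)); exists c.
  by have [f hf] := choice hc; exists f.
(* [mu j] comes from passing the common t-part and the inverse power from passing the z-part. The
   shift by [k1], left over from the first separation, is common to all terms, so the eigenvalue
   still determines [k j]. *)
pose ev (k : 'I_n -> nat) (j : 'I_n) : K := mu j * (alpha (b j) j ^+ (k j + k1 j))^-1.
have evP k j : t j * (tdeg d0 * zmon k * zmon k1) = ev k j *: (tdeg d0 * zmon k * zmon k1 * t j).
  rewrite -(mulrA _ (zmon k)) zmonD mulrA (hmu j).2 -scalerAl -!mulrA zmon_gen -scalerAr.
  by rewrite scalerA /ev mulfVK // expf_neq0 // alpha_neq0.
pose C2 (p : K * idx) := p.2.2 == k0.
have [w2 Iw2] : exists w, I (\sum_(p <- s1 | C2 p)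
    foldr (fun (j : {j | act j}) u => u * t (val j)) (p.1 *: (mon p.2 * zmon k1)) w).
  apply: (@class_separation K A {j | act j} _ (fun j u => t (val j) * u)
     (fun j u => u * t (val j)) (fun i j => nu (val i) (val j)) I _ _ _ _ _ _ _ s1 C2
     (fun p => p.1 *: (mon p.2 * zmon k1)) (fun p j => ev p.2.2 (val j))
     (fun j => ev k0 (val j))) => //.
  - by move=> i j; have [] := hnu (val i) (val j).
  - move=> i j u c h; rewrite mulrA h -scalerAl -!mulrA (hnu (val j) (val i)).2.
    by rewrite -scalerAr scalerA.
  - by move=> j u Iu; apply: ideal_mull.
  - by move=> j u Iu; apply: ideal_mulr.
  - move=> p j; rewrite mem_filter => /andP[/eqP d0E ps].
    by rewrite /mon d0E -scalerAr evP -scalerAl !scalerA mulrC.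
  - by move=> p j ps /eqP ->.
  - move=> p; rewrite mem_filter => /andP[_ ps].
    case: (pselect (exists j, p.2.2 j != k0 j)); last first.
      by move=> h /eqP[]; apply/ffunP => j; apply/eqP; apply: contrapT => /negP hj; apply: h; exists j.
    case=> j hj _; have aj : act j.
      by apply: contraNT hj => aj; rewrite (proj2 (hs p j ps aj)).
    exists (exist _ j aj); apply: contraNneq hj => /= /(mulfI (hmu j).1)/invr_inj.
    by move/alpha_pow_inj/addIn => ->.
  - move: Iw1; rewrite /s1 big_filter; congr I; apply: eq_bigr => p _.
    by rewrite k1E -scalerAl.
have [m' prm] := @foldr_t act b (fun j => absz (d0 j)) (fun j => (k0 j + k1 j)%N) w2.
exists (fun j => (k0 j + k1 j)%N); split=> [j aj|]; first by rewrite k10 ?addn0.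
apply: (@tmon_remove I b m') => //; apply: (ideal_prop hI prm).1.
have foldZ w a v : foldr (fun (j : {j | act j}) u => u * t (val j)) (a *: v) w =
    a *: foldr (fun (j : {j | act j}) u => u * t (val j)) v w.
  by elim: w => //= j w ->; rewrite scalerAl.
(* The surviving terms all have index [(d0, k0)], so their sum is one monomial times the total
   coefficient, nonzero by [cs]. *)
rewrite -[foldr _ _ _]scale1r -(mulVf cs) -scalerA; apply: ideal_scale => //.
move: Iw2; congr I; rewrite scaler_suml /s1 big_filter_cond; apply: eq_big => [[a [d k]] //|p].
move=> /andP[/eqP dE /eqP kE]; rewrite foldZ /mon dE kE; congr (_ *: foldr _ _ _).
by rewrite -mulrA zmonD.
Qed.

(** * Ideals avoiding monomials in the [z_i], and the grading *)

(** [N] is the kernel of the representation with [c = 1] on [C] and [c = 0] elsewhere. Since [z_i]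
    acts by [c_i q_i^(d_i - 1)], it dies off [C], while monomials supported on [C] act by a nowhere
    vanishing function. *)
Lemma zmon_avoid (C : pred 'I_n) : exists N : A -> Prop,
  [/\ ideal N, forall i, ~~ C i -> N (z i)
    & forall k, (forall j, ~~ C j -> k j = 0%N) -> ~ N (zmon k)].
Proof.
pose c j : K := if C j then 1 else 0.
have [[f [f_hom fxy]] _] := hA.2 _ _ _ (rep_rel c hq0 q_sub1 hlam0 hlaminv).
have [f_lin f1 fM] := f_hom.
have fz i v d : f (z i) v d = c i * q i ^ (d i - 1) * v d.
  have fB u w : f (u - w) = f u - f w.
    by rewrite addrC -scaleN1r f_lin scaleN1r addrC.
  by rewrite fB !fM; have [-> ->] := fxy i; apply: zrepE.
exists (fun u => f u = 0); split.
- exact: ideal_preim f_hom (ideal_zero _).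
- move=> i Ci; apply: repP => v d; rewrite fz /c (negPf Ci) !mul0r.
  by [].
move=> k kC; pose D u := exists e : ('I_n -> int) -> K,
  (forall d, e d != 0) /\ forall v d, f u v d = e d * v d.
have D1 : D 1 by exists (fun=> 1); split=> *; rewrite ?oner_neq0 // f1 mul1r.
have DM u w : D u -> D w -> D (u * w).
  move=> [e [e0 eE]] [e' [e'0 e'E]]; exists (fun d => e d * e' d).
  by split=> *; rewrite ?mulf_neq0 // fM repM eE e'E mulrA.
have [e [e0 eE]] : D (zmon k).
  apply: (big_ind D) => // j _; have [Cj|/kC ->] := boolP (C j); last by rewrite expr0.
  elim: (k j) => [|m IH]; rewrite ?expr0 // exprS; apply: DM => //.
  exists (fun d => q j ^ (d j - 1)); split=> *; rewrite ?expfz_neq0 //.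
  by rewrite fz /c Cj mul1r.
move=> fk0; have := eE (fun=> 1) (fun=> 0); rewrite fk0 mulr1 => /esym/eqP.
by rewrite (negPf (e0 _)).
Qed.

Lemma zmon_neq0 k : zmon k <> 0.
Proof.
have [N [hN _ hk]] := zmon_avoid predT.
by move=> k0; apply: (hk k) => //; rewrite k0; apply: ideal0.
Qed.

Lemma zmon_notin_z i k : k i = 0%N -> ~ gen_ideal (z i) (zmon k).
Proof.
have [N [hN Nz hk]] := zmon_avoid (predC1 i).
move=> ki /(_ N hN (Nz i _)); rewrite /= eqxx => /(_ isT); apply: hk => j /=.
by rewrite negbK => /eqP ->.
Qed.

(* The automorphism rescaling y_i0 by q_i0 and x_i0 by its inverse; its eigenvalues
   detect the degree d_i0 even modulo z_i0, where z_i0 cannot. *)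
Lemma grading i0 : exists f : A -> A,
  [/\ alg_hom f, f (z i0) = z i0 & forall p, f (mon p) = q i0 ^ p.1 i0 *: mon p].
Proof.
pose cs b j := if j == i0 then alpha b j else 1.
have cs1 j : cs true j * cs false j = 1.
  by rewrite /cs /alpha; case: eqP => _; rewrite ?mulVf ?mulr1.
have [hlt heq] := hA.1.
have hrel : qweyl_rel q lam (fun j => cs true j *: x j) (fun j => cs false j *: y j).
  split=> [i j /hlt[h1 h2 h3 h4]|i]; last first.
    rewrite -[RHS](heq i) -!scalerAl -!scalerAr !scalerA cs1 scale1r.
    by rewrite -[q i * _ * _]mulrA (mulrC (cs false i)) cs1 mulr1.
  by split; rewrite -!scalerAl -!scalerAr !scalerA ?h1 ?h2 ?h3 ?h4 !scalerA; congr (_ *: _); ring.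
have [[f [f_hom fxy]] _] := hA.2 _ _ _ hrel; have [f_lin f1 fM] := f_hom.
have fB u w : f (u - w) = f u - f w by rewrite addrC -scaleN1r f_lin scaleN1r addrC.
have fgen b j : f (gen b j) = cs b j *: gen b j by case: b; have [] := fxy j.
have fz j : f (z j) = z j.
  rewrite fB !fM (fgen true) (fgen false) -!scalerAl -!scalerAr !scalerA.
  by rewrite (mulrC (cs false j)) cs1 !scale1r.
have fX u a m : f u = a *: u -> f (u ^+ m) = a ^+ m *: u ^+ m.
  by move=> fu; elim: m => [|m IH]; rewrite ?expr0 ?f1 ?scale1r // !exprS fM IH fu -scalerAl -scalerAr scalerA.
have fprod (F : 'I_n -> A) (a : 'I_n -> K) : (forall j, f (F j) = a j *: F j) ->
    f (\prod_j F j) = (\prod_j a j) *: \prod_j F j.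
  move=> fF; elim: (index_enum _) => [|j r IH]; first by rewrite !big_nil f1 scale1r.
  by rewrite !big_cons fM IH fF -scalerAl -scalerAr scalerA.
exists f; split=> // p; rewrite /mon fM scalerAl; congr (_ * _); last first.
  rewrite /zmon (fprod _ (fun=> 1)); first by rewrite big1_eq scale1r.
  by move=> j; rewrite (fX _ 1) ?expr1n // fz scale1r.
rewrite /tdeg /tmon (fprod _ (fun j => if j == i0 then q i0 ^ p.1 i0 else 1)).
  by rewrite -big_mkcond big_pred1_eq.
move=> j; rewrite (fX _ _ _ (fgen _ _)) /cs; case: eqP => [->|_]; last by rewrite expr1n.
by rewrite alpha_expz.
Qed.

(** * Primeness of zero and of [(z_i)] *)

Lemma nonzero_ideal_zmon I u : ideal I -> I u -> u != 0 -> exists k, I (zmon k).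
Proof.
move=> hI; have [s ->] := msum_span u => Is /class_coef_neq0[[d k] [_ cs]].
by have [//|k' [_ Ik']] := @monomial_in_ideal predT I s d k hI _ Is cs; exists k'.
Qed.

(** If [u A v = 0] with [u] and [v] nonzero, the two annihilator ideals successively replace them by
    monomials in the [z_j], whose product would be a vanishing monomial. *)
Lemma zero_prime : prime_ideal (fun u : A => u = 0).
Proof.
have h0 := ideal_zero A; apply/prime_idealP => //; first exact/eqP/oner_neq0.
move=> u v uv; have [->|u0] := eqVneq u 0; first by left.
right; apply/eqP; apply: contraT => v0.
have [k hk] := nonzero_ideal_zmon (ideal_lannul v h0) uv u0.
have [l hl] := nonzero_ideal_zmon (ideal_rannul (zmon k) h0) hk v0.
by have := hl 1; rewrite mulr1 zmonD => /zmon_neq0.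
Qed.

Lemma mon_z_ideal i (p : idx) : p.2 i != 0%N -> gen_ideal (z i) (mon p).
Proof.
move=> pi; have hP := gen_ideal_ideal (z i); suff h : gen_ideal (z i) (zmon p.2) by exact: (ideal_mull _ hP h).
have -> : zmon p.2 = z i * zmon (fun j => p.2 j - (j == i))%N.
  rewrite -{1}(zmon1 i) zmonD; apply: eq_zmon => j; case: eqP => [->|_]; last by rewrite subn0.
  by rewrite subnKC // lt0n.
have h : gen_ideal (z i) (z i) by move=> I.
exact: (ideal_mulr _ hP h).
Qed.

(** Terms divisible by [z_i0] are dropped. The rest share degree [E] and exponent 0 at [i0], so only
    the other indices need separating and no factor [z_i0] is ever introduced. *)
Lemma homogeneous_zmon_mod i0 (I : A -> Prop) (s : seq (K * idx)) (E : int) : ideal I -> I (z i0) ->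
    (forall p, p \in s -> p.2.1 i0 = E) -> I (msum s) -> ~ gen_ideal (z i0) (msum s) ->
  exists k, k i0 = 0%N /\ I (zmon k).
Proof.
move=> hI Iz sE Is nPs; have hP := gen_ideal_ideal (z i0).
pose s' := [seq p : K * idx <- s | p.2.2 i0 == 0%N].
have Pss' : gen_ideal (z i0) (msum s - msum s').
  rewrite /msum (bigID (fun p : K * idx => p.2.2 i0 == 0%N)) /= /s' big_filter addrAC subrr add0r.
  by apply: (ideal_sum _ hP) => p pi; apply: (ideal_scale _ hP); apply: mon_z_ideal.
have Is' : I (msum s') by apply: (ideal_congr hI (Pss' I hI Iz)).1.
have : msum s' != 0.
  apply/eqP => s'0; apply: nPs; apply: (ideal_congr hP Pss').2.
  by rewrite s'0; apply: (ideal0 hP).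
case/class_coef_neq0 => -[d k] [/mapP[p ps' pE] cs].
have hs' r : r \in s' -> r.2.1 i0 = E /\ r.2.2 i0 = 0%N.
  by rewrite mem_filter => /andP[/eqP -> /sE].
have [|k' [k'E Ik']] := @monomial_in_ideal (predC1 i0) I s' d k hI _ Is' cs.
  move=> r j /hs'[rE r0] /=; rewrite negbK => /eqP ->.
  by have [] := hs' p ps'; rewrite -pE /= => -> ->.
exists k'; split=> //; rewrite k'E /= ?eqxx //.
by have [] := hs' p ps'; rewrite -pE.
Qed.

(** A component of highest degree that lies in [(z_i0)] is discarded and the next one examined;
    since [u] is outside the ideal, some component survives. *)
Lemma top_component i0 u : ~ gen_ideal (z i0) u -> exists (s : seq (K * idx)) (E : int),
  [/\ forall p, p \in s -> (p.2.1 i0 <= E)%R, gen_ideal (z i0) (u - msum s)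
    & ~ gen_ideal (z i0) (msum [seq p : K * idx <- s | p.2.1 i0 == E])].
Proof.
have hP := gen_ideal_ideal (z i0); have [s ->] := msum_span u.
have [m] := ubnP (size s); elim: m s => // m IH s le_m nPs.
have s0 : s != [::].
  by apply: contra_notN nPs => /eqP ->; rewrite /msum big_nil; apply: (ideal0 hP).
have [p ps pmax] := seq_max (fun p : K * idx => p.2.1 i0) s0.
pose E := p.2.1 i0; pose s1 := [seq p : K * idx <- s | p.2.1 i0 == E].
case: (pselect (gen_ideal (z i0) (msum s1))) => Ps1; last first.
  by exists s, E; split=> //; rewrite subrr; apply: (ideal0 hP).
pose s2 := [seq p : K * idx <- s | p.2.1 i0 != E].
have sE : msum s = msum s1 + msum s2.
  by rewrite /msum !big_filter (bigID (fun p : K * idx => p.2.1 i0 == E)).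
have Ps2 : gen_ideal (z i0) (msum s - msum s2) by rewrite sE addrK.
have [||s' [E' [h1 h2 h3]]] := IH s2.
- rewrite -ltnS; apply: leq_trans le_m; rewrite ltnS size_filter ltn_neqAle -all_count.
  by rewrite count_size andbT; apply/allPn; exists p; rewrite //= eqxx.
- by move/(ideal_congr hP Ps2).2.
exists s', E'; split=> //.
by rewrite -(subrK (msum s2) (msum s)) -addrA; apply: (ideal_add hP).
Qed.

(* If u A v lies in (z_i0), so does U A W for the top d_i0-degree components U, W. *)
Lemma gen_z_prime i0 : prime_ideal (gen_ideal (z i0)).
Proof.
have hP := gen_ideal_ideal (z i0).
have Pz : gen_ideal (z i0) (z i0) by move=> I.
apply/prime_idealP => //; first by rewrite -zmon0; apply: zmon_notin_z.
move=> u v uv; case: (pselect (gen_ideal (z i0) u)) => Pu; first by left.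
right; apply: contrapT => Pv.
have [s [E [sE us nPs]]] := top_component Pu; have [t [F [tF vt nPt]]] := top_component Pv.
have [U UE] : exists U, U = msum [seq p : K * idx <- s | p.2.1 i0 == E] by eexists.
have [W WE] : exists W, W = msum [seq p : K * idx <- t | p.2.1 i0 == F] by eexists.
have [f [f_hom fz fmon]] := grading i0.
have Pf w : gen_ideal (z i0) w -> gen_ideal (z i0) (f w).
  by move=> Pw I hI Iz; apply: (Pw (fun w => I (f w)));
    [apply: ideal_preim|rewrite fz].
have UrW r : gen_ideal (z i0) (U * r * W).
  have [r' ->] := msum_span r.
  rewrite /msum mulr_sumr mulr_suml; apply: (ideal_sum _ hP) => p _.
  rewrite -scalerAr -scalerAl; apply: (ideal_scale _ hP).
  set M := mon p.2.
  (* Modulo [(z_i0)], [u] and [v] may be replaced by the chosen combinations of monomials. *)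
  have PsMt : gen_ideal (z i0) (msum s * M * msum t).
    apply: (ideal_congr hP _).1 (uv M).
    rewrite -(subrK (msum s * M * v) (u * M * v)) -!mulrBl -addrA -mulrBr.
    by apply: (ideal_add hP); [rewrite -mulrA; apply: (ideal_mulr _ hP)|apply: (ideal_mull _ hP)].
  pose st := [seq (a, b) | a <- s, b <- t].
  pose term (ab : (K * idx) * (K * idx)) := (ab.1.1 *: mon ab.1.2) * M * (ab.2.1 *: mon ab.2.2).
  pose C (ab : (K * idx) * (K * idx)) := ab.1.2.1 i0 + ab.2.2.1 i0 == E + F.
  have [f_lin _ fM] := f_hom.
  have fZ a w : f (a *: w) = a *: f w.
    have f0 : f 0 = 0 by have := f_lin (-1) 0 0; rewrite scaler0 addr0 scaleN1r addNr.
    by have := f_lin a w 0; rewrite f0 !addr0.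
  have [w Pw] : exists w : seq unit,
      gen_ideal (z i0) (\sum_(ab <- st | C ab) foldr (fun _ u => u) (term ab) w).
    (* The single operator is the grading automorphism, paired with the identity, so the fold
       changes nothing. The eigenvalue of a product records its total degree at [i0], to which [M]
       contributes a constant. *)
    apply: (@class_separation K A unit _ (fun _ => f) (fun _ u => u) (fun _ _ => 1)
      (gen_ideal (z i0)) _ _ _ _ _ _ _ st C term
      (fun ab _ => q i0 ^ (ab.1.2.1 i0 + ab.2.2.1 i0 + p.2.1 i0))
      (fun _ => q i0 ^ (E + F + p.2.1 i0))) => //.
    - by move=> _ _; apply: oner_neq0.
    - by move=> _ _ u' c; rewrite mulr1.
    - by move=> a u' v' Pu' Pv'; apply: (ideal_add hP) => //; apply: (ideal_scale _ hP).
    - move=> [a b] _ _; rewrite /term /M 2!fM !fZ !fmon !expfzDr //=.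
      by rewrite -!scalerAl -!scalerAr -!scalerAl !scalerA; congr (_ *: _); ring.
    - by move=> ab _ _ /eqP ->.
    - move=> ab _ nC; exists tt; apply: contra nC => /eqP /expz_q_inj /addIr h.
      by rewrite /C h.
    - move: PsMt; congr gen_ideal; rewrite /st big_allpairs_dep /=.
      rewrite /msum !mulr_suml; apply: eq_bigr => a _.
      by rewrite mulr_sumr.
  move: Pw; congr gen_ideal.
  have foldE u' : foldr (fun (_ : unit) (u : A) => u) u' w = u' by elim: w.
  rewrite (eq_bigr _ (fun ab _ => foldE (term ab))) /st big_mkcond big_allpairs_dep /=.
  rewrite UE WE /msum !big_filter !mulr_suml [RHS]big_mkcond /=.
  rewrite big_seq [RHS]big_seq; apply: eq_bigr => a /sE aE.
  rewrite mulr_sumr [X in _ = if _ then X else _]big_mkcond big_seq /=.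
  case: eqP => [aE'|/eqP aE'].
    rewrite [RHS]big_seq; apply: eq_bigr => b bt.
    by rewrite /C /= aE' (inj_eq (addrI _)).
  (* Here [a] has degree below [E] and no [b] exceeds [F], so the total [E + F] is not reached. *)
  rewrite big1 // => b /tF bF; rewrite /C /= ifF //; apply/negbTE.
  apply: contra aE' => /eqP e; rewrite Order.POrderTheory.eq_le aE /=.
  by rewrite -(Num.Theory.lerD2r F) -e Num.Theory.lerD2l.
rewrite {}UE {}WE in UrW.
have sub_lann w : gen_ideal (z i0) w -> forall b r, gen_ideal (z i0) (w * r * b).
  by move=> Pw b r; rewrite -mulrA; apply: (ideal_mulr _ hP).
(* As for the zero ideal, [U] and [W] are replaced in turn by monomials; neither involves [z_i0], so
   their product stays outside [(z_i0)]. *)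
have [|k [k0 hk]] :=
    @homogeneous_zmon_mod i0 _ _ E (ideal_lannul _ hP) (sub_lann _ Pz _) _ UrW nPs.
- by move=> p; rewrite mem_filter => /andP[/eqP].
have [|l [l0 hl]] := @homogeneous_zmon_mod i0 _ _ F (ideal_rannul (zmon k) hP)
    (fun r => ideal_mull (zmon k * r) hP Pz) _ hk nPt.
- by move=> p; rewrite mem_filter => /andP[/eqP].
have := hl 1; rewrite mulr1 zmonD; apply: zmon_notin_z.
by rewrite k0 l0.
Qed.

(** * Primes of height one *)

Lemma z_normal i r : exists r', z i * r = r' * z i.
Proof.
have [s ->] := msum_span r.
exists (\sum_(p <- s) p.1 *: (q i ^ p.2.1 i *: mon p.2)).
rewrite /msum mulr_sumr mulr_suml; apply: eq_bigr => p _.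
by rewrite -scalerAr z_mon -!scalerAl.
Qed.

(** By normality, [z_j v] in [P] forces [z_j A v] into [P], so primeness strips off one factor at a
    time; the factors cannot run out because 1 is not in [P]. *)
Lemma prime_zmon (P : A -> Prop) k : prime_ideal P -> P (zmon k) -> exists j, P (z j).
Proof.
move=> prP; have [hP P1 _] := prP; have hpr := (prime_idealP hP P1).1 prP.
have zM j v : P (z j * v) -> P (z j) \/ P v.
  move=> zv; apply: hpr => r; have [r' ->] := z_normal j r.
  by rewrite -mulrA; apply: ideal_mull.
rewrite /zmon; elim: (index_enum _) => [|j s IH]; first by rewrite big_nil.
rewrite big_cons; elim: (k j) => [|m IHm]; first by rewrite expr0 mul1r.
by rewrite exprS -mulrA => /zM[Pj|//]; exists j.
Qed.

Lemma prime_contains_z (P : A -> Prop) u : prime_ideal P -> P u -> u != 0 -> exists j, P (z j).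
Proof.
move=> prP Pu u0; have [hP _ _] := prP.
by have [k Pk] := nonzero_ideal_zmon hP Pu u0; apply: prime_zmon prP Pk.
Qed.

Lemma z_in_gen_z i j : gen_ideal (z i) (z j) -> j = i.
Proof.
rewrite -[z j]zmon1 => h; apply/eqP; apply: contraPT h => ji.
by apply: zmon_notin_z; rewrite eq_sym (negPf ji).
Qed.

Lemma height_one_primes (P : A -> Prop) :
  height_one_prime P <-> exists i, forall u, P u <-> gen_ideal (z i) u.
Proof.
have z0 i : z i != 0 by rewrite -zmon1; apply/eqP/zmon_neq0.
have zero_sub i : strict_sub (fun u => u = 0) (gen_ideal (z i)).
  split=> [u ->|]; first exact: ideal0 (gen_ideal_ideal _).
  by exists (z i); split; [move=> I|apply/eqP].
have nonzero_sub (Q1 Q2 : A -> Prop) : ideal Q1 -> strict_sub Q1 Q2 -> exists2 u, Q2 u & u != 0.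
  move=> hQ1 [_ [u [Q2u Q1u]]]; exists u => //.
  by apply: contra_notN Q1u => /eqP ->; apply: ideal0.
split=> [[prP [Q [[hQ _ _] QP]] hP]|[i Pz]].
  have [u Pu u0] := nonzero_sub _ _ hQ QP.
  have [i Pi] := prime_contains_z prP Pu u0; exists i => v.
  have [hPi _ _] := prP; split=> [Pv|]; last by apply.
  apply: contrapT => nv; apply: hP.
  (* If [P] were larger than [(z_i)], this would be a forbidden chain of primes below [P]. *)
  exists (fun u => u = 0), (gen_ideal (z i)); split=> //.
  - exact: zero_prime.
  - exact: gen_z_prime.
  - by split=> [w|]; [apply|exists v].
have PE : P = gen_ideal (z i) by apply/funext => u; apply/propext.
rewrite PE; split; first exact: gen_z_prime.
  by exists (fun u => u = 0); split; [apply: zero_prime|].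
case=> Q1 [Q2 [[hQ1 _ _] prQ2 Q12 [Q2P [u [Pu nQ2u]]]]].
have [v Q2v v0] := nonzero_sub _ _ hQ1 Q12.
(* The middle prime contains some [z_j]; lying in [(z_i)] forces [j = i], so it already equals
   [(z_i)]. *)
have [j Q2j] := prime_contains_z prQ2 Q2v v0; have [hQ2 _ _] := prQ2.
have ji := z_in_gen_z (Q2P _ Q2j); subst j.
exact: nQ2u (Pu _ hQ2 Q2j).
Qed.
End QWeyl.

Theorem theorem1p2 (K : fieldType) (n : nat) (q : 'I_n -> K)
    (lam : 'I_n -> 'I_n -> K)
    (hn : (0 < n)%N)
    (hq0 : forall i, q i != 0)
    (hqroot : forall i (k : nat), (0 < k)%N -> q i ^+ k != 1)
    (hlam0 : forall i j, lam i j != 0)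
    (hlaminv : forall i j, lam i j = (lam j i)^-1)
    (hlamdiag : forall i, lam i i = 1)
    (A : algType K) (x y : 'I_n -> A)
    (hA : is_qweyl_algebra q lam x y) :
  forall P : A -> Prop,
    height_one_prime P <->
    exists i : 'I_n, forall u, P u <-> gen_ideal (x i * y i - y i * x i) u.
Proof. by move=> P; apply: (height_one_primes hq0 hqroot hlam0 hlaminv hA). Qed.
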